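(* Let $\Lambda \subset \mathbb{R}^n$ be a lattice of full rank $n$, and let $L_k \subset \Lambda$ be a sublattice of rank $k$, where $1 \leq k < n$. Let $\mu = \mu(\Lambda)$ be the covering radius of $\Lambda$ and write $\lambda_k = \lambda_k(L_k)$. Then the polynomial $$p(v) = \left( \frac{\mu^2}{\lambda_k^2}(1 - v^4) - v^2(v^4 - v^2 + 1) \right)^2 - \left( \frac{2\mu^2}{\lambda_k^2} v(1 - v^4) + 2v^4 \right)^2 (1 - v^2)$$ has a root in the interval $(0,1)$, and, with $v_*$ denoting its smallest root in $(0,1)$, there exists a sublattice $L_{k+1} \subset \Lambda$ of rank $k+1$ such that $L_{k+1}$ is an extension of $L_k$, $\lambda_j(L_{k+1}) = \lambda_j(L_k)$ for all $1 \leq j \leq k$, and $$\lambda_{k+1}(L_{k+1}) \leq \frac{\lambda_k(L_k)\left(v_*^2 + \sqrt{1 - v_*^2}\right)}{\sqrt{1 - v_*^4}} + 2\mu.$$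
   Context: A lattice of rank $m$ in $\mathbb{R}^n$ is $\Lambda = A\mathbb{Z}^m$ for a real $n \times m$ matrix $A$ of rank $m$. Let $B(r)$ denote the closed ball of radius $r$ centered at the origin in $\operatorname{span}_{\mathbb{R}}\Lambda$ (Euclidean norm). The successive minima of $\Lambda$ are $\lambda_i(\Lambda) = \min\{ r \in \mathbb{R} : \dim_{\mathbb{R}} \operatorname{span}_{\mathbb{R}}(B(r) \cap \Lambda) \geq i \}$ for $1 \leq i \leq m$. The covering radius of $\Lambda$ is $\mu(\Lambda) = \min\{ r \in \mathbb{R} : \Lambda + B(r) = \operatorname{span}_{\mathbb{R}}\Lambda \}$. If $L \subset M$ are lattices with the rank of $L$ smaller than that of $M$, then $M$ is an extension of $L$ if $M \cap \operatorname{span}_{\mathbb{R}} L = L$. *)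

(* Defs.v *)
From mathcomp Require Import all_boot all_order all_algebra.
From mathcomp Require Import all_classical all_reals.

Set Implicit Arguments.
Unset Strict Implicit.
Unset Printing Implicit Defensive.

Import Order.TTheory GRing.Theory Num.Theory.

Local Open Scope classical_set_scope.
Local Open Scope ring_scope.

Definition is_lattice (R : realType) (n m : nat) (L : set 'cV[R]_n) : Prop :=
  exists A : 'M[R]_(n, m),
    \rank A = m /\ L = [set A *m map_mx intr z | z in [set: 'cV[int]_m]].

Definition is_span (R : realType) (n : nat) (S : set 'cV[R]_n)
    (U : {vspace 'cV[R]_n}) : Prop :=
  S `<=` [set` U] /\
  forall W : {vspace 'cV[R]_n}, S `<=` [set` W] -> (U <= W)%VS.

(* The library's [span] takes a finite sequence of vectors, whereas here S is
   an arbitrary set. The default value 0%VS of [xget] is never used on account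
   of its failing: see [spanRP]. *)
Definition spanR (R : realType) (n : nat) (S : set 'cV[R]_n) :
    {vspace 'cV[R]_n} :=
  xget 0%VS [set U | is_span S U].

Lemma spanRP (R : realType) (n : nat) (S : set 'cV[R]_n) :
  is_span S (spanR S).
Proof.
apply: (@xgetPex _ 0%VS [set U | is_span S U]).
suff H (d : nat) (U : {vspace 'cV[R]_n}) :
    (\dim (fullv : {vspace 'cV[R]_n}) - \dim U <= d)%N ->
    (forall W : {vspace 'cV[R]_n}, S `<=` [set` W] -> (U <= W)%VS) ->
    exists V, is_span S V.
  by apply: (H _ 0%VS (leqnn _)) => W _; exact: sub0v.
elim: d U => [|d IHd] U dU minU.
  exists U; split=> // x _ /=.
  suff /eqP -> : U == fullv by exact: memvf.
  by rewrite eqEdim subvf /= -subn_eq0 -leqn0.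
have [SU|/existsNP[x /not_implyP[Sx /= /negP xU]]] := pselect (S `<=` [set` U]).
  by exists U.
apply: (IHd (U + <[x]>)%VS); last first.
  by move=> W SW; rewrite subv_add minU //= -memvE; exact: SW.
have ltU : (\dim U < \dim (U + <[x]>))%N.
  rewrite ltnNge; apply/negP => dimle.
  have /eqP eqU : U == (U + <[x]>)%VS by rewrite eqEdim addvSl.
  by move/negP: xU; apply; rewrite memvE eqU addvSr.
have leF : (\dim (U + <[x]>) <= \dim (fullv : {vspace 'cV[R]_n}))%N.
  exact: dimvS (subvf _).
rewrite -ltnS; apply: leq_trans dU.
by apply: ltn_sub2l => //; apply: leq_trans leF.
Qed.

(* The library's norm on matrices is the sup norm. *)
Definition euclid_norm (R : realType) (n : nat) (x : 'cV[R]_n) : R :=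
  Num.sqrt (\sum_(i < n) x i 0 ^+ 2).

Definition span_ball (R : realType) (n : nat) (L : set 'cV[R]_n) (r : R) :
    set 'cV[R]_n :=
  [set x | x \in spanR L /\ euclid_norm x <= r].

Definition is_min (R : realType) (E : set R) (r : R) : Prop :=
  E r /\ lbound E r.

(* The value is 0 if E has no least element. *)
Definition set_min (R : realType) (E : set R) : R :=
  xget 0 [set r | is_min E r].

Definition succ_min (R : realType) (n : nat) (i : nat) (L : set 'cV[R]_n) : R :=
  set_min [set r : R | (i <= \dim (spanR (span_ball L r `&` L)))%N].

Definition covering_radius (R : realType) (n : nat) (L : set 'cV[R]_n) : R :=
  set_min [set r : R |
    [set x + y | x in L & y in span_ball L r] = [set` spanR L]].

Definition is_extension (R : realType) (n : nat) (L M : set 'cV[R]_n) : Prop :=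
  exists l m : nat,
    [/\ is_lattice l L, is_lattice m M, (l < m)%N, L `<=` M &
        M `&` [set` spanR L] = L].

(* a stands for mu^2 / lambda_k^2. *)
Definition angle_poly (R : realType) (a : R) : {poly R} :=
  (a *: (1 - 'X^4) - 'X^2 * ('X^4 - 'X^2 + 1)) ^+ 2
  - ((2 * a) *: ('X * (1 - 'X^4)) + 2 *: 'X^4) ^+ 2 * (1 - 'X^2).

Definition is_smallest_root01 (R : realType) (p : {poly R}) (v : R) : Prop :=
  [/\ 0 < v < 1, root p v & forall w : R, 0 < w < 1 -> root p w -> v <= w].

(* Main.v *)
Require Import Defs.
From mathcomp Require Import all_boot all_order all_algebra.
From mathcomp Require Import all_classical all_reals.
From mathcomp Require Import polyrcf ring lra.

Import Order.TTheory GRing.Theory Num.Theory.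

Local Open Scope classical_set_scope.
Local Open Scope ring_scope.

(** The bound to be proved is at least [lambda_k + 2 mu], because its factor
    [(v ^ 2 + sqrt (1 - v ^ 2)) / sqrt (1 - v ^ 4)] is at least 1 on (0, 1)
    ([angle_factor_ge1]). It therefore suffices to construct an extension with
    [lambda_(k+1) <= lambda_k + 2 mu].

    Choose a unit vector [e] orthogonal to the span of [L_k]. The covering
    property gives a point [y] of [Lambda] within [mu] of [(lambda_k + mu) e]
    ([high_point_exists]). It has length at most [lambda_k + 2 mu] and height
    [dotmx e y] at least [lambda_k > 0]. Put [L_(k+1) = Z y + L_k]. A vector of
    [L_(k+1)] outside [L_k] has a nonzero coefficient on [y], hence height, and
    so length, at least [lambda_k] ([adjoin_short]). So it does not lie in the
    span of [L_k], which makes [L_(k+1)] an extension, and the vectors shorter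
    than [lambda_k] are the same in both lattices, which preserves the first
    [k] minima. Finally [y] and [k] independent vectors of [L_k] of length at
    most [lambda_k] fit in the ball of radius [|y|]
    ([adjoin_succ_min_last]).

    The successive minima and the covering radius are genuine minima because a
    lattice has finitely many points in a ball, so that just outside any
    sphere there is a shell free of lattice points ([lattice_norm_gap]).

    The polynomial has a root in (0, 1) by the intermediate value theorem
    ([angle_poly_root]), and a smallest one as it has finitely many. *)

(** * Euclidean geometry *)

Definition dotmx {R : realType} {n : nat} (u v : 'cV[R]_n) : R :=
  (u^T *m v) 0 0.

Lemma dotmxE {R : realType} {n : nat} (u v : 'cV[R]_n) :
  dotmx u v = \sum_(i < n) u i 0 * v i 0.
Proof. by rewrite /dotmx !mxE; apply: eq_bigr => i _; rewrite mxE. Qed.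

Lemma dotmxDr {R : realType} {n : nat} (u v w : 'cV[R]_n) :
  dotmx u (v + w) = dotmx u v + dotmx u w.
Proof. by rewrite /dotmx mulmxDr mxE. Qed.

Lemma dotmxZr {R : realType} {n : nat} (c : R) (u v : 'cV[R]_n) :
  dotmx u (c *: v) = c * dotmx u v.
Proof. by rewrite /dotmx -scalemxAr mxE. Qed.

Lemma dotmxC {R : realType} {n : nat} (u v : 'cV[R]_n) :
  dotmx u v = dotmx v u.
Proof. by rewrite !dotmxE; apply: eq_bigr => i _; rewrite mulrC. Qed.

Lemma euclid_norm_ge0 {R : realType} {n : nat} (x : 'cV[R]_n) :
  0 <= euclid_norm x.
Proof. exact: sqrtr_ge0. Qed.

Lemma euclid_norm_sqr {R : realType} {n : nat} (x : 'cV[R]_n) :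
  euclid_norm x ^+ 2 = dotmx x x.
Proof.
rewrite dotmxE sqr_sqrtr; first by apply: eq_bigr => i _; rewrite expr2.
by apply: sumr_ge0 => i _; exact: sqr_ge0.
Qed.

Lemma euclid_norm0_eq0 {R : realType} {n : nat} (x : 'cV[R]_n) :
  euclid_norm x <= 0 -> x = 0.
Proof.
move=> x_le0; have {x_le0} : euclid_norm x ^+ 2 = 0.
  by apply/eqP; rewrite sqrf_eq0 eq_le x_le0 euclid_norm_ge0.
rewrite euclid_norm_sqr dotmxE => /eqP.
rewrite psumr_eq0 => [/allP x0|i _]; last by rewrite -expr2 sqr_ge0.
apply/matrixP => i j; rewrite ord1 mxE; apply/eqP.
by have := x0 i (mem_index_enum _); rewrite /= mulf_eq0 orbb.
Qed.

Lemma euclid_normZ {R : realType} {n : nat} (c : R) (x : 'cV[R]_n) :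
  0 <= c -> euclid_norm (c *: x) = c * euclid_norm x.
Proof.
move=> c_ge0; apply/eqP; rewrite -(@eqrXn2 _ 2) ?mulr_ge0 ?euclid_norm_ge0 //.
by rewrite exprMn !euclid_norm_sqr dotmxZr dotmxC dotmxZr mulrA -expr2.
Qed.

(** Cauchy-Schwarz, from the squared norm of [|v| u - |u| v]. *)
Lemma dotmx_le_norm {R : realType} {n : nat} (u v : 'cV[R]_n) :
  dotmx u v <= euclid_norm u * euclid_norm v.
Proof.
have [v0|] := eqVneq (euclid_norm v) 0.
  have -> : v = 0 by apply: euclid_norm0_eq0; rewrite v0.
  by rewrite -(scale0r (0 : 'cV_n)) dotmxZr mul0r mulr_ge0 ?euclid_norm_ge0.
move=> v0; have v_gt0 : 0 < euclid_norm v by rewrite lt0r v0 euclid_norm_ge0.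
have : 0 <= euclid_norm (euclid_norm v *: u + - euclid_norm u *: v) ^+ 2.
  exact: sqr_ge0.
rewrite euclid_norm_sqr dotmxDr !dotmxZr (dotmxC _ u) (dotmxC _ v).
rewrite !dotmxDr !dotmxZr (dotmxC v u) -!euclid_norm_sqr.
have := euclid_norm_ge0 u; rewrite le0r => /predU1P[u0 _|u_gt0 h].
  have -> : u = 0 by apply: euclid_norm0_eq0; rewrite u0.
  rewrite dotmxC -(scale0r (0 : 'cV_n)) dotmxZr mul0r.
  by rewrite mulr_ge0 ?euclid_norm_ge0.
rewrite -(ler_pM2l (mulr_gt0 u_gt0 v_gt0)).
nra.
Qed.

Lemma euclid_normD {R : realType} {n : nat} (x y : 'cV[R]_n) :
  euclid_norm (x + y) <= euclid_norm x + euclid_norm y.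
Proof.
rewrite -(@ler_pXn2r _ 2) ?nnegrE ?addr_ge0 ?euclid_norm_ge0 //.
rewrite euclid_norm_sqr dotmxDr ![dotmx (x + y) _]dotmxC !dotmxDr.
rewrite (dotmxC y x) -!euclid_norm_sqr.
have := dotmx_le_norm x y; nra.
Qed.

Lemma euclid_normN {R : realType} {n : nat} (x : 'cV[R]_n) :
  euclid_norm (- x) = euclid_norm x.
Proof.
by congr Num.sqrt; apply: eq_bigr => i _; rewrite mxE sqrrN.
Qed.

Lemma abs_dotmx_le_norm {R : realType} {n : nat} (u v : 'cV[R]_n) :
  `|dotmx u v| <= euclid_norm u * euclid_norm v.
Proof.
rewrite ler_norml dotmx_le_norm andbT lerNl -mulN1r -dotmxZr scaleN1r.
by rewrite -(euclid_normN v) dotmx_le_norm.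
Qed.

Lemma abs_coord_le_norm {R : realType} {n : nat} (x : 'cV[R]_n) (i : 'I_n) :
  `|x i 0| <= euclid_norm x.
Proof.
rewrite -sqrtr_sqr ler_sqrt; last by apply: sumr_ge0 => j _; exact: sqr_ge0.
by rewrite (bigD1 i) //= lerDl; apply: sumr_ge0 => j _; exact: sqr_ge0.
Qed.

Lemma euclid_norm_mono {R : realType} {n : nat} (x y : 'cV[R]_n) :
  (forall i, `|x i 0| <= y i 0) -> euclid_norm x <= euclid_norm y.
Proof.
move=> le_xy; rewrite ler_sqrt; last by apply: sumr_ge0 => j _; exact: sqr_ge0.
apply: ler_sum => i _; rewrite -(real_normK (num_real (x i 0))).
by rewrite ler_pXn2r ?nnegrE // (le_trans _ (le_xy i)).
Qed.

Lemma abs_mulmx_coord_le {R : realType} {m n : nat} (A : 'M[R]_(n, m))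
    (x : 'cV[R]_m) (c : R) (i : 'I_n) :
  (forall j, `|x j 0| <= c) -> `|(A *m x) i 0| <= (\sum_j `|A i j|) * c.
Proof.
move=> x_le; rewrite mxE mulr_suml; apply: le_trans (ler_norm_sum _ _ _) _.
by apply: ler_sum => j _; rewrite normrM ler_wpM2l.
Qed.

(** A rank-deficient family has a unit normal: normalise a vector of the left
    kernel. *)
Lemma unit_normal_exists {R : realType} {n m : nat} (A : 'M[R]_(n, m)) :
  (\rank A < n)%N -> exists e : 'cV[R]_n, euclid_norm e = 1 /\ e^T *m A = 0.
Proof.
move=> rkA; have : kermx A != 0 by rewrite -mxrank_eq0 mxrank_ker subn_eq0 -ltnNge.
move=> /rowV0Pn[v /sub_kermxP vA v0].
have nv_gt0 : 0 < euclid_norm v^T.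
  rewrite ltNge; apply: contra_neqN v0 => /euclid_norm0_eq0 vT0.
  by rewrite -(trmxK v) vT0 trmx0.
exists ((euclid_norm v^T)^-1 *: v^T); split.
  by rewrite euclid_normZ ?invr_ge0 ?ltW // mulVf // gt_eqF.
by rewrite linearZ /= trmxK -scalemxAl vA scaler0.
Qed.

(** * Lattices *)

Lemma lattice_mem0 {R : realType} {n m : nat} {L : set 'cV[R]_n} :
  is_lattice m L -> L 0.
Proof.
move=> [A [_ ->]]; exists 0 => //.
by rewrite (_ : map_mx _ _ = 0) ?mulmx0 //; apply/matrixP => i j; rewrite !mxE.
Qed.

(** A left inverse of the basis matrix recovers the integer coordinates of a
    lattice point from the point, so a bounded set of lattice points has
    boundedly many integer coordinates. *)
Lemma lattice_locally_finite {R : realType} {n m : nat} {L : set 'cV[R]_n}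
    (x : 'cV[R]_n) (r : R) :
  is_lattice m L ->
  exists s : seq 'cV[R]_n, forall y, L y -> euclid_norm (y - x) <= r -> y \in s.
Proof.
move=> [A [rkA ->]].
have /row_fullP[B BA] : row_full A by rewrite /row_full rkA.
(* Every entry of [B *m y] is at most [C * euclid_norm y] in absolute value;
   the functions [f] encode the integers from [- N] to [N]. *)
pose C := \sum_(i < m) \sum_(j < n) `|B i j|.
pose N := Num.bound (C * (r + euclid_norm x)).
pose pt (f : {ffun 'I_m -> 'I_(N + N).+1}) : 'cV[R]_n :=
  A *m map_mx intr (\col_i ((f i : nat)%:Z - N%:Z)).
exists [seq pt f | f <- enum {: {ffun 'I_m -> 'I_(N + N).+1}}].
move=> _ [z _ <-] zr; set y := A *m _ in zr *.
have y_le : euclid_norm y <= r + euclid_norm x.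
  by rewrite -(subrK x y) (le_trans (euclid_normD _ _)) // lerD2r.
have z_le i : `|z i 0| <= N%:Z.
  rewrite -(ler_int R) intr_norm.
  have -> : (z i 0)%:~R = (B *m y) i 0.
    by rewrite mulmxA BA mul1mx !mxE.
  apply: le_trans (abs_mulmx_coord_le _ _ _ _
    (fun j => le_trans (abs_coord_le_norm y j) y_le)) _.
  have rx0 : 0 <= r + euclid_norm x := le_trans (euclid_norm_ge0 y) y_le.
  have C0 : 0 <= C by apply: sumr_ge0 => ? _; apply: sumr_ge0.
  apply: le_trans (ltW (archi_boundP (mulr_ge0 C0 rx0))).
  apply: ler_wpM2r => //; rewrite /C (bigD1 i) //= lerDl.
  by apply: sumr_ge0 => ? _; apply: sumr_ge0.
apply/mapP; exists [ffun i => inord (absz (z i 0 + N%:Z))].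
  by rewrite mem_enum.
congr (A *m map_mx _ _); apply/matrixP => i j; rewrite ord1 !mxE ffunE.
have := z_le i; rewrite ler_norml => /andP[z_ge z_le'].
have zN : 0 <= z i 0 + N%:Z by rewrite -lerBlDr sub0r.
rewrite inordK; first by rewrite gez0_abs // addrK.
by rewrite ltnS -lez_nat gez0_abs // PoszD lerD2r.
Qed.

(** Local finiteness leaves an empty shell just outside every sphere; this is
    what makes the infima defining successive minima and covering radius
    attained. *)
Lemma lattice_norm_gap {R : realType} {n m : nat} {L : set 'cV[R]_n}
    (x : 'cV[R]_n) (r : R) :
  is_lattice m L ->
  exists2 r' : R, r < r' &
    forall y, L y -> euclid_norm (y - x) < r' -> euclid_norm (y - x) <= r.
Proof.
move=> /(lattice_locally_finite x (r + 1))[s sP].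
have [r' r_lt r'P] : exists2 r' : R, r < r' & forall y, y \in s ->
    euclid_norm (y - x) < r' -> euclid_norm (y - x) <= r.
  elim: s {sP} => [|y s [r' r_lt IHs]]; first by exists (r + 1) => //; lra.
  have [y_le|y_gt] := leP (euclid_norm (y - x)) r.
    by exists r' => // w /predU1P[->//|]; exact: IHs.
  exists (Num.min r' (euclid_norm (y - x))); first by rewrite lt_min r_lt.
  move=> w; rewrite in_cons lt_min => /predU1P[->|ws] /andP[wr'].
    by rewrite ltxx.
  by move=> _; exact: IHs.
exists (Num.min r' (r + 1)); first by rewrite lt_min r_lt; lra.
move=> y Ly; rewrite lt_min => /andP[yr' /ltW yr1].
by apply: r'P => //; exact: sP.
Qed.

Lemma mulmx_sum_col {R : comPzRingType} {n m : nat} (A : 'M[R]_(n, m))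
    (c : 'cV[R]_m) :
  A *m c = \sum_j c j 0 *: col j A.
Proof.
apply/matrixP => i j; rewrite ord1 summxE !mxE; apply: eq_bigr => l _.
by rewrite !mxE mulrC.
Qed.

Lemma lattice_col {R : realType} {n m : nat} (A : 'M[R]_(n, m)) (j : 'I_m) :
  [set A *m map_mx intr z | z in [set: 'cV[int]_m]] (col j A).
Proof.
exists (delta_mx j 0) => //; rewrite colE; congr (_ *m _).
by apply/matrixP => a b; rewrite !mxE; case: andP.
Qed.

Lemma spanR_basis {R : realType} {n m : nat} {A : 'M[R]_(n, m)}
    {L : set 'cV[R]_n} (c : 'cV[R]_m) :
  L = [set A *m map_mx intr z | z in [set: 'cV[int]_m]] ->
  A *m c \in spanR L.
Proof.
move=> LE; have [Lspan _] := spanRP L.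
rewrite mulmx_sum_col; apply: memv_suml => j _; apply: memvZ; apply: Lspan.
by rewrite LE; exact: lattice_col.
Qed.

Lemma spanR_full {R : realType} {n : nat} {L : set 'cV[R]_n} (x : 'cV[R]_n) :
  is_lattice n L -> x \in spanR L.
Proof.
move=> [A [rkA LE]].
have Au : A \in unitmx by rewrite -row_full_unit /row_full rkA.
by rewrite -(mulKVmx Au x); exact: spanR_basis.
Qed.

Lemma spanR_dim_ge {R : realType} {n m : nat} {L : set 'cV[R]_n} :
  is_lattice m L -> (m <= \dim (spanR L))%N.
Proof.
move=> [A [rkA LE]].
have /row_fullP[B BA] : row_full A by rewrite /row_full rkA.
pose f := linfun (mulmx A : 'cV[R]_m -> 'cV[R]_n).
have kerf : lker f = 0%VS.
  apply/eqP; rewrite -subv0; apply/subvP => x.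
  rewrite memv_ker lfunE /= memv0 => /eqP Ax.
  by rewrite -(mul1mx x) -BA -mulmxA Ax mulmx0.
have -> : m = \dim (f @: fullv).
  by rewrite limg_dim_eq ?kerf ?capv0 // dimvf /dim /= muln1.
apply: dimvS; apply/subvP => _ /memv_imgP[x _ ->].
by rewrite lfunE /=; exact: spanR_basis.
Qed.

Lemma spanR_sub {R : realType} {n : nat} {S : set 'cV[R]_n}
    {U : {vspace 'cV[R]_n}} :
  S `<=` [set` U] -> (spanR S <= U)%VS.
Proof. by have [_] := spanRP S; apply. Qed.

Lemma spanRS {R : realType} {n : nat} {S T : set 'cV[R]_n} :
  S `<=` T -> (spanR S <= spanR T)%VS.
Proof.
by move=> ST; apply: spanR_sub; apply: subset_trans ST (proj1 (spanRP T)).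
Qed.

(** [spanR] being a least subspace, it is compared with the kernel of pairing
    with [e]. *)
Lemma spanR_orth {R : realType} {n : nat} {S : set 'cV[R]_n} {e x : 'cV[R]_n} :
  (forall y, S y -> dotmx e y = 0) -> x \in spanR S -> dotmx e x = 0.
Proof.
move=> eS; pose f := linfun (mulmx e^T : 'cV[R]_n -> 'cV[R]_1).
have fP y : (y \in lker f) = (dotmx e y == 0).
  rewrite memv_ker lfunE /=; apply/eqP/eqP => [ey|ey].
    by rewrite /dotmx ey mxE.
  by apply/matrixP => i j; rewrite !ord1 [RHS]mxE.
have /spanR_sub /subvP/(_ x) : S `<=` [set` lker f].
  by move=> y /eS /eqP; rewrite /= fP.
by rewrite fP => h /h /eqP.
Qed.

Lemma sub_span_ball {R : realType} {n : nat} {L : set 'cV[R]_n} {r : R}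
    {x : 'cV[R]_n} :
  (span_ball L r `&` L) x <-> L x /\ euclid_norm x <= r.
Proof.
split=> [[[_ xr] Lx]//|[Lx xr]]; split=> //; split=> //.
exact: (proj1 (spanRP L)).
Qed.

(** * Attained minima *)

Lemma set_minE {R : realType} {E : set R} {r : R} : is_min E r -> set_min E = r.
Proof.
move=> minr; apply: xget_unique => // s [Es minS].
by apply/eqP; rewrite eq_le (minS _ (proj1 minr)) (proj2 minr _ Es).
Qed.

Lemma set_minP {R : realType} {E : set R} :
  E !=set0 -> has_lbound E -> E (inf E) -> is_min E (set_min E).
Proof.
move=> E0 lbE Einf; have minE : is_min E (inf E) by split=> //; exact: ge_inf.
by rewrite (set_minE minE).
Qed.

(** The set of radii whose least element is the [i]-th successive minimum. *)
Definition rank_radii {R : realType} {n : nat} (i : nat) (L : set 'cV[R]_n) :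
    set R :=
  [set r : R | (i <= \dim (spanR (span_ball L r `&` L)))%N].

Lemma rank_radii_sub {R : realType} {n : nat} {i : nat} {L M : set 'cV[R]_n}
    {r s : R} :
  (forall x, L x -> euclid_norm x <= r -> M x /\ euclid_norm x <= s) ->
  rank_radii i L r -> rank_radii i M s.
Proof.
move=> LM /leq_trans; apply; apply: dimvS; apply: spanRS => x.
by move=> /sub_span_ball[Lx xr]; apply/sub_span_ball/LM.
Qed.

(** A ball of nonpositive radius contains at most the origin. *)
Lemma rank_radii_gt0 {R : realType} {n : nat} {i : nat} {L : set 'cV[R]_n}
    {r : R} :
  (0 < i)%N -> rank_radii i L r -> 0 < r.
Proof.
move=> i_gt0 /(leq_trans i_gt0) dim_gt0; rewrite ltNge; apply/negP => r_le0.
have : (spanR (span_ball L r `&` L) <= 0)%VS.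
  apply: spanR_sub => x /sub_span_ball[_ xr].
  by rewrite /= memv0 (euclid_norm0_eq0 x) // (le_trans xr).
by move=> /dimvS; rewrite dimv0 leqNgt dim_gt0.
Qed.

Lemma rank_radii_nonempty {R : realType} {n m : nat} {L : set 'cV[R]_n} :
  is_lattice m L -> rank_radii m L !=set0.
Proof.
move=> latL; have [A [rkA LE]] := latL.
pose r := \sum_j euclid_norm (col j A); exists r.
apply: leq_trans (spanR_dim_ge latL) _; apply: dimvS.
apply: spanR_sub => _ /[!LE] -[z _ <-] /=.
rewrite mulmx_sum_col; apply: memv_suml => j _; apply: memvZ.
apply: (proj1 (spanRP _)); rewrite -LE; apply/sub_span_ball; split.
  by rewrite LE; exact: lattice_col.
by rewrite /r (bigD1 j) //= lerDl; apply: sumr_ge0 => l _; exact: euclid_norm_ge0.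
Qed.

(** Below the gap that follows the infimum [r] no lattice vector is longer than
    [r], so a radius just above [r] sees the same vectors as [r]. *)
Lemma succ_minP {R : realType} {n m : nat} {i : nat} {L : set 'cV[R]_n} :
  is_lattice m L -> (1 <= i <= m)%N -> is_min (rank_radii i L) (succ_min i L).
Proof.
move=> latL /andP[i_gt0 im].
have E0 : rank_radii i L !=set0.
  by have [r rP] := rank_radii_nonempty latL; exists r; exact: leq_trans rP.
have lbE : has_lbound (rank_radii i L).
  by exists 0 => r /(rank_radii_gt0 i_gt0) /ltW.
apply: set_minP => //; set r := inf _.
have [r' r_lt gap] := lattice_norm_gap 0 r latL.
have [||s Es s_lt] := @inf_adherent _ (rank_radii i L) (r' - r).
- by rewrite subr_gt0.
- by split.
apply: rank_radii_sub Es => x Lx xs; split=> //.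
have := gap x Lx; rewrite subr0; apply; apply: le_lt_trans xs _.
by rewrite -/r addrC subrK in s_lt.
Qed.

Definition cover_radii {R : realType} {n : nat} (L : set 'cV[R]_n) : set R :=
  [set r : R | [set x + y | x in L & y in span_ball L r] = [set` spanR L]].

Lemma cover_radiiP {R : realType} {n : nat} {L : set 'cV[R]_n} {r : R} :
  is_lattice n L ->
  cover_radii L r <-> forall x, exists2 y, L y & euclid_norm (y - x) <= r.
Proof.
move=> latL; split=> [cov x|cov].
  have : [set` spanR L] x by exact: spanR_full.
  rewrite -cov => -[y Ly [b [_ br] <-]]; exists y => //.
  by rewrite opprD addrA subrr add0r euclid_normN.
apply/seteqP; split=> x _ /=; first exact: spanR_full.
have [y Ly yx] := cov x; exists y => //; exists (x - y); last by rewrite addrC subrK.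
by split; [exact: spanR_full | rewrite -euclid_normN opprB].
Qed.

(** Rounding coordinates down moves a point by a vector with coordinates in
    [0, 1), which is of bounded length. *)
Lemma cover_radii_nonempty {R : realType} {n : nat} {L : set 'cV[R]_n} :
  is_lattice n L -> cover_radii L !=set0.
Proof.
move=> latL; have [A [rkA LE]] := latL.
have Au : A \in unitmx by rewrite -row_full_unit /row_full rkA.
exists (euclid_norm (\col_i \sum_j `|A i j|)).
apply/(cover_radiiP latL) => x.
pose z : 'cV[int]_n := map_mx Num.floor (invmx A *m x).
exists (A *m map_mx intr z); first by rewrite LE; exists z.
rewrite -[X in _ - X](mulKVmx Au x) -mulmxBr; apply: euclid_norm_mono => i.
rewrite [leRHS]mxE -[leRHS]mulr1; apply: abs_mulmx_coord_le => j; rewrite !mxE.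
set t := \sum_l _; have /andP[] := floor_itv t.
by rewrite intrD ler_norml; lra.
Qed.

(** A radius in the gap that follows the infimum [r] covers a point [x] by a
    lattice point at distance at most [r]; the gap may depend on [x]. *)
Lemma covering_radiusP {R : realType} {n : nat} {L : set 'cV[R]_n} :
  is_lattice n L -> is_min (cover_radii L) (covering_radius L).
Proof.
move=> latL; have E0 := cover_radii_nonempty latL.
have lbE : has_lbound (cover_radii L).
  exists 0 => r /(cover_radiiP latL)/(_ 0)[y _]; exact/le_trans/euclid_norm_ge0.
apply: set_minP => //; set r := inf _; apply/(cover_radiiP latL) => x.
have [r' r_lt gap] := lattice_norm_gap x r latL.
have [||s /(cover_radiiP latL)/(_ x)[y Ly ys] s_lt] :=
    @inf_adherent _ (cover_radii L) (r' - r).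
- by rewrite subr_gt0.
- by split.
exists y => //; apply: gap => //; apply: le_lt_trans ys _.
by rewrite -/r addrC subrK in s_lt.
Qed.

(** * The angle polynomial *)

Lemma angle_polyE {R : realType} (a v : R) :
  (angle_poly a).[v] =
    (a * (1 - v ^+ 4) - v ^+ 2 * (v ^+ 4 - v ^+ 2 + 1)) ^+ 2
    - (2 * a * (v * (1 - v ^+ 4)) + 2 * v ^+ 4) ^+ 2 * (1 - v ^+ 2).
Proof. by rewrite /angle_poly !hornerE. Qed.

(** The polynomial is [F ^ 2 - H ^ 2 (1 - v ^ 2)] with [F] running from [a] at 0
    to [-1] at 1. For [a > 0] it is nonpositive at a zero of [F] and equals 1
    at 1, so it vanishes in between. For [a = 0] the zero of [F] is at 0, which
    says nothing, but there [p / v ^ 4] has a double zero where [v ^ 2] is the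
    inverse golden ratio. *)
Lemma angle_poly_root {R : realType} (a : R) :
  0 <= a -> exists v : R, 0 < v < 1 /\ root (angle_poly a) v.
Proof.
rewrite le0r => /predU1P[->|a_gt0].
  pose u : R := (Num.sqrt 5 - 1) / 2.
  have s5 : Num.sqrt 5 ^+ 2 = 5 :> R by rewrite sqr_sqrtr.
  have s5_ge0 : 0 <= Num.sqrt 5 :> R by exact: sqrtr_ge0.
  have u_gt0 : 0 < u by rewrite /u; nra.
  have u_lt1 : u < 1 by rewrite /u; nra.
  have uu : u ^+ 2 = 1 - u by rewrite /u; nra.
  have su : Num.sqrt u ^+ 2 = u by rewrite sqr_sqrtr ?ltW.
  exists (Num.sqrt u); split.
    by rewrite sqrtr_gt0 u_gt0 -sqrtr1 ltr_sqrt.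
  rewrite /root angle_polyE -[4%N]/(2 * 2)%N exprM su uu; apply/eqP.
  ring: uu.
(* The opposite of the bracket [F], so that it goes from [- a] to 1. *)
pose G : {poly R} := 'X^2 * ('X^4 - 'X^2 + 1) - a *: (1 - 'X^4).
have GE v : G.[v] = v ^+ 2 * (v ^+ 4 - v ^+ 2 + 1) - a * (1 - v ^+ 4).
  by rewrite /G !hornerE.
have [||w /andP[w_ge0 w_le1] /eqP Gw] := @poly_ivt R G 0 1.
- exact: ler01.
- by rewrite !GE !expr0n !expr1n /=; lra.
have w_gt0 : 0 < w.
  rewrite lt0r w_ge0 andbT; apply/eqP => w0.
  by move: Gw; rewrite w0 GE !expr0n /=; lra.
have w_lt1 : w < 1.
  rewrite lt_neqAle w_le1 andbT; apply/eqP => w1.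
  by move: Gw; rewrite w1 GE !expr1n; lra.
have [||v /andP[wv v_le1] pv] := @poly_ivt R (angle_poly a) w 1.
- exact: ltW.
- rewrite !angle_polyE !expr1n; apply/andP; split; last by lra.
  rewrite (_ : a * _ - _ = 0); last by rewrite -oppr0 -Gw GE opprB.
  rewrite expr0n /= sub0r oppr_le0.
  by rewrite mulr_ge0 ?sqr_ge0 // subr_ge0 expr_le1.
exists v; split=> //; rewrite (lt_le_trans w_gt0 wv) /= lt_neqAle v_le1 andbT.
apply/eqP => v1; move: pv; rewrite v1 /root angle_polyE !expr1n => /eqP.
by lra.
Qed.

Lemma smallest_root01_exists {R : realType} (p : {poly R}) :
  p != 0 -> (exists v : R, 0 < v < 1 /\ root p v) ->
  exists v, is_smallest_root01 p v.
Proof.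
move=> p_neq0 [v [v01 pv]].
have in_rts w : (w \in roots p 0 1) = root p w && (0 < w < 1).
  by rewrite in_roots p_neq0 andbT in_itv.
have := sorted_roots 0 1 p; case rE: (roots p 0 1) => [|u s].
  by have := in_rts v; rewrite rE pv v01.
move=> /(order_path_min lt_trans) /allP u_min.
have := in_rts u; rewrite rE mem_head => /esym/andP[pu u01].
exists u; split=> // w w01 pw.
have := in_rts w; rewrite rE pw w01 in_cons => /predU1P[->//|].
by move=> /u_min /ltW.
Qed.

(** Writing [sqrt (1 - v ^ 4)] as [sqrt (1 - v ^ 2) * sqrt (1 + v ^ 2)] and
    bounding the last factor by [1 + v ^ 2 / 2] shows it to be at most
    [sqrt (1 - v ^ 2) + v ^ 2 / 2]. *)
Lemma angle_factor_ge1 {R : realType} (v : R) :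
  0 < v < 1 ->
  1 <= (v ^+ 2 + Num.sqrt (1 - v ^+ 2)) / Num.sqrt (1 - v ^+ 4).
Proof.
move=> /andP[v_gt0 v_lt1].
have v2_lt1 : v ^+ 2 < 1 by rewrite expr_lt1 // ltW.
have v2_ge0 := sqr_ge0 v; set u := v ^+ 2 in v2_lt1 v2_ge0 *.
have -> : v ^+ 4 = u ^+ 2 by rewrite -exprM.
have s_gt0 : 0 < Num.sqrt (1 - u ^+ 2) by rewrite sqrtr_gt0; nra.
rewrite ler_pdivlMr // mul1r.
have s2 : Num.sqrt (1 - u ^+ 2) ^+ 2 = 1 - u ^+ 2 by rewrite sqr_sqrtr //; nra.
have t2 : Num.sqrt (1 - u) ^+ 2 = 1 - u by rewrite sqr_sqrtr // subr_ge0 ltW.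
have t_ge0 : 0 <= Num.sqrt (1 - u) by exact: sqrtr_ge0.
set s := Num.sqrt (1 - u ^+ 2) in s_gt0 s2 *.
set t := Num.sqrt (1 - u) in t2 t_ge0 *.
rewrite -(@ler_pXn2r _ 2) ?nnegrE ?addr_ge0 ?(ltW s_gt0) // s2.
(* Expanding [(u + t) ^+ 2] with [t ^+ 2 = 1 - u], this says that
   [u (2 u - 1 + 2 t) >= 0], which follows from [t >= t ^+ 2]. *)
nra.
Qed.

(** * Adjoining a high lattice point *)

Definition adjoin {R : realType} {n : nat} (L : set 'cV[R]_n) (y : 'cV[R]_n) :
    set 'cV[R]_n :=
  [set x | exists (c : int) (l : 'cV[R]_n), L l /\ x = c%:~R *: y + l].

Lemma sub_adjoin {R : realType} {n : nat} {L : set 'cV[R]_n} {y : 'cV[R]_n} :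
  L `<=` adjoin L y.
Proof. by move=> l Ll; exists 0, l; rewrite scale0r add0r. Qed.

Lemma mem_adjoin {R : realType} {n m : nat} {L : set 'cV[R]_n} {y : 'cV[R]_n} :
  is_lattice m L -> adjoin L y y.
Proof. by move=> /lattice_mem0 L0; exists 1, 0; rewrite scale1r addr0. Qed.

Lemma adjoin_sub {R : realType} {n m : nat} {L M : set 'cV[R]_n}
    {y : 'cV[R]_n} :
  is_lattice m M -> L `<=` M -> M y -> adjoin L y `<=` M.
Proof.
move=> [A [_ ->]] LM [z _ <-] _ [c [l [/LM [w _ <-] ->]]].
exists (c *: z + w) => //; rewrite scalemxAr -mulmxDr; congr (_ *m _).
by apply/matrixP => i j; rewrite !mxE intrD intrM.
Qed.

Lemma dotmx_adjoin {R : realType} {n : nat} {L : set 'cV[R]_n}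
    {e y l : 'cV[R]_n} (c : R) :
  (forall x, L x -> dotmx e x = 0) -> l \in spanR L ->
  dotmx e (c *: y + l) = c * dotmx e y.
Proof.
by move=> orthL Ll; rewrite dotmxDr dotmxZr (spanR_orth orthL Ll) addr0.
Qed.

(** The matrix [row_mx y A] is a basis: pairing a linear relation with [e] kills
    the coefficient of [y], and the rest is a relation between the columns of
    [A]. *)
Lemma adjoin_lattice {R : realType} {n k : nat} {L : set 'cV[R]_n}
    {e y : 'cV[R]_n} :
  is_lattice k L -> (forall x, L x -> dotmx e x = 0) -> dotmx e y != 0 ->
  is_lattice k.+1 (adjoin L y).
Proof.
move=> [A [rkA LE]] orthL ey.
have mulyE (S : pzRingType) (f : S -> R) (c : 'M[S]_1) :
    y *m map_mx f c = f (c 0 0) *: y.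
  by apply/matrixP => i j; rewrite !ord1 !mxE big_ord1 !mxE mulrC.
exists (row_mx y A : 'M_(n, 1 + k)); split.
  apply/eqP; rewrite -mxrank_tr; apply: inj_row_free => v vA0.
  have : row_mx y A *m v^T = 0 by rewrite -[LHS]trmxK trmx_mul trmxK vA0 trmx0.
  pose t : 'cV[R]_(1 + k) := v^T; rewrite -/t -[t]vsubmxK.
  set c := usubmx _; set w := dsubmx _.
  rewrite mul_row_col -(map_mx_id (frefl id) c) mulyE => cw0.
  have c0 : c 0 0 = 0.
    have := dotmx_adjoin (c 0 0) orthL (spanR_basis w LE) (y := y).
    rewrite cw0 -(scale0r (0 : 'cV_n)) dotmxZr mul0r => /esym/eqP.
    by rewrite mulf_eq0 (negPf ey) orbF => /eqP.
  have w0 : w = 0.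
    have [B BA] : exists B, B *m A = 1%:M.
      by apply/row_fullP; rewrite /row_full rkA.
    move: cw0; rewrite c0 scale0r add0r => Aw0.
    by rewrite -(mul1mx w) -BA -mulmxA Aw0 mulmx0.
  apply: trmx_inj; rewrite -/t -[t]vsubmxK -/c -/w w0 [c]mx11_scalar c0.
  by rewrite raddf0 col_mx0 trmx0.
have MzE (z : 'cV[int]_(1 + k)) : row_mx y A *m map_mx intr z =
    (usubmx z 0 0)%:~R *: y + A *m map_mx intr (dsubmx z).
  by rewrite -{1}[z]vsubmxK map_col_mx mul_row_col mulyE.
apply/seteqP; split=> [_ [c [l [Ll ->]]]|_ [z _ <-]].
  move: Ll; rewrite LE => -[z _ <-].
  exists (col_mx (const_mx c : 'cV_1) z) => //; apply: etrans (MzE _) _.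
  by rewrite col_mxKu col_mxKd mxE.
pose t : 'cV[int]_(1 + k) := z.
exists (usubmx t 0 0), (A *m map_mx intr (dsubmx t)); split; last exact: MzE.
by rewrite LE; exists (dsubmx t).
Qed.

Lemma adjoin_extension {R : realType} {n k : nat} {L : set 'cV[R]_n}
    {e y : 'cV[R]_n} :
  is_lattice k L -> (forall x, L x -> dotmx e x = 0) -> dotmx e y != 0 ->
  is_extension L (adjoin L y).
Proof.
move=> latL orthL ey; exists k, k.+1; split=> //.
- exact: adjoin_lattice latL orthL ey.
- exact: sub_adjoin.
have Lspan := proj1 (spanRP L).
apply/seteqP; split=> [_ [[c [l [Ll ->]]] /(spanR_orth orthL)]|x Lx].
  rewrite (dotmx_adjoin _ orthL (Lspan _ Ll)) => /eqP.
  by rewrite mulf_eq0 (negPf ey) orbF => /eqP ->; rewrite scale0r add0r.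
by split; [exact: sub_adjoin | exact: Lspan].
Qed.

(** Each coset [c y + L] with [c] nonzero lies in a hyperplane at distance
    [|c| h >= h] from the origin. *)
Lemma adjoin_short {R : realType} {n : nat} {L : set 'cV[R]_n}
    {e x y : 'cV[R]_n} :
  euclid_norm e = 1 -> (forall x, L x -> dotmx e x = 0) ->
  adjoin L y x -> euclid_norm x < dotmx e y -> L x.
Proof.
move=> e1 orthL [c [l [Ll ->]]] x_lt; have [->|c0] := eqVneq c 0.
  by rewrite scale0r add0r.
have := abs_dotmx_le_norm e (c%:~R *: y + l); rewrite e1 mul1r.
rewrite (dotmx_adjoin _ orthL (proj1 (spanRP L) _ Ll)) normrM -intr_norm.
have c1 : 1 <= `|c|%:~R :> R by rewrite ler1z -gtz0_ge1 normr_gt0.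
move=> /(le_lt_trans)/(_ x_lt); have := ler_norm (dotmx e y).
have := normr_ge0 (dotmx e y); nra.
Qed.

(** The two lattices have the same vectors of length less than
    [lambda_k <= dotmx e y]. *)
Lemma adjoin_succ_min {R : realType} {n k j : nat} {L : set 'cV[R]_n}
    {e y : 'cV[R]_n} :
  is_lattice k L -> euclid_norm e = 1 -> (forall x, L x -> dotmx e x = 0) ->
  succ_min k L <= dotmx e y -> (1 <= j <= k)%N ->
  succ_min j (adjoin L y) = succ_min j L.
Proof.
move=> latL e1 orthL h_ge jk; have /andP[j1 j_le] := jk.
have [Ej minj] := succ_minP latL jk.
have [Ek _] := succ_minP latL (introT andP (conj (leq_trans j1 j_le) (leqnn k))).
have j_le_k : succ_min j L <= succ_min k L by apply: minj; exact: leq_trans Ek.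
apply: set_minE; split.
  by apply: rank_radii_sub Ej => x Lx xr; split=> //; exact: sub_adjoin.
move=> r Er; rewrite leNgt; apply/negP => r_lt.
suff /minj : rank_radii j L r by rewrite leNgt r_lt.
apply: rank_radii_sub Er => x Lx xr; split=> //.
apply: (adjoin_short e1 orthL Lx); apply: le_lt_trans xr _.
exact: lt_le_trans r_lt (le_trans j_le_k h_ge).
Qed.

(** The ball of radius [|y| >= dotmx e y >= lambda_k] contains [y] together with
    [k] independent vectors of [L]. *)
Lemma adjoin_succ_min_last {R : realType} {n k : nat} {L : set 'cV[R]_n}
    {e y : 'cV[R]_n} :
  (0 < k)%N ->
  is_lattice k L -> euclid_norm e = 1 -> (forall x, L x -> dotmx e x = 0) ->
  succ_min k L <= dotmx e y ->
  succ_min k.+1 (adjoin L y) <= euclid_norm y.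
Proof.
move=> k_gt0 latL e1 orthL h_ge.
have [Ek _] := succ_minP latL (introT andP (conj k_gt0 (leqnn k))).
have l_gt0 := rank_radii_gt0 k_gt0 Ek.
have ey : dotmx e y != 0 by rewrite gt_eqF // (lt_le_trans l_gt0).
have latM := adjoin_lattice latL orthL ey.
have [_] := @succ_minP _ _ _ k.+1 _ latM (leqnn k.+1); apply.
have ly : succ_min k L <= euclid_norm y.
  by apply: le_trans h_ge _; rewrite -[leRHS]mul1r -e1 dotmx_le_norm.
set U := spanR (span_ball L (succ_min k L) `&` L) in Ek.
have U_le : (U + <[y]> <=
    spanR (span_ball (adjoin L y) (euclid_norm y) `&` adjoin L y))%VS.
  rewrite subv_add -memvE spanRS => [/=|x /sub_span_ball[Lx xl]].
    apply: (proj1 (spanRP _)); apply/sub_span_ball; split=> //.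
    exact: mem_adjoin latL.
  by apply/sub_span_ball; split; [exact: sub_adjoin | exact: le_trans ly].
apply: leq_trans (dimvS U_le).
have y_notin : y \notin U.
  apply: contra_neqN ey; apply: spanR_orth => x /sub_span_ball[Lx _].
  exact: orthL.
have Uy : (U :&: <[y]> = 0)%VS.
  apply/eqP; rewrite -subv0; apply/subvP => x /memv_capP[xU /vlineP[c xE]].
  rewrite memv0 xE; have [->|c0] := eqVneq c 0; first by rewrite scale0r.
  by move: xU; rewrite xE rpredZeq (negPf c0) (negPf y_notin).
rewrite dimv_disjoint_sum // dim_vline.
have -> : y != 0 by apply: contraNneq y_notin => ->; exact: mem0v.
by rewrite addn1.
Qed.

(** A ball of radius [mu] centred at height [lambda_k + mu] on the normal
    contains a lattice point, and its lowest point is at height [lambda_k]. *)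
Lemma high_point_exists {R : realType} {n : nat} {M : set 'cV[R]_n}
    (e : 'cV[R]_n) (l : R) :
  is_lattice n M -> euclid_norm e = 1 -> 0 <= l ->
  exists y, [/\ M y, l <= dotmx e y &
    euclid_norm y <= l + 2 * covering_radius M].
Proof.
move=> latM e1 l_ge0; set mu := covering_radius M.
have [/(cover_radiiP latM) cov _] := covering_radiusP latM.
have [y My y_le] := cov ((l + mu) *: e); rewrite -/mu in y_le.
have mu_ge0 : 0 <= mu := le_trans (euclid_norm_ge0 _) y_le.
exists y; split=> //.
  have -> : y = (l + mu) *: e + (y - (l + mu) *: e) by rewrite addrC subrK.
  rewrite dotmxDr dotmxZr -euclid_norm_sqr e1 expr1n mulr1.
  have := abs_dotmx_le_norm e (y - (l + mu) *: e).
  by rewrite e1 mul1r ler_norml => /andP[+ _]; lra.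
have -> : y = (l + mu) *: e + (y - (l + mu) *: e) by rewrite addrC subrK.
apply: le_trans (euclid_normD _ _) _.
by rewrite euclid_normZ ?addr_ge0 // e1 mulr1; lra.
Qed.

Theorem theorem1p2 (R : realType) (n k : nat) (Lambda Lk : set 'cV[R]_n)
  (hk : (1 <= k < n)%N)
  (hLambda : is_lattice n Lambda)
  (hLk : is_lattice k Lk)
  (hsub : Lk `<=` Lambda) :
  let mu := covering_radius Lambda in
  let lambda_k := succ_min k Lk in
  let p := angle_poly (mu ^+ 2 / lambda_k ^+ 2) in
  (exists v : R, 0 < v < 1 /\ root p v) /\
  exists vstar : R,
    is_smallest_root01 p vstar /\
    exists Lk1 : set 'cV[R]_n,
      [/\ is_lattice k.+1 Lk1,
          Lk1 `<=` Lambda,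
          is_extension Lk Lk1,
          forall j : nat, (1 <= j <= k)%N -> succ_min j Lk1 = succ_min j Lk
        & succ_min k.+1 Lk1 <=
            lambda_k * (vstar ^+ 2 + Num.sqrt (1 - vstar ^+ 2))
              / Num.sqrt (1 - vstar ^+ 4)
            + 2 * mu].
Proof.
move=> mu lambda_k p; have /andP[k_gt0 k_lt_n] := hk.
have p_root : exists v : R, 0 < v < 1 /\ root p v.
  by apply: angle_poly_root; rewrite divr_ge0 ?sqr_ge0.
split=> //.
have p_neq0 : p != 0.
  apply/negP => /eqP/(congr1 (horner^~ 1)).
  by rewrite angle_polyE horner0 !expr1n; lra.
have [v v_min] := smallest_root01_exists _ p_neq0 p_root; exists v; split=> //.
have [Ek _] := succ_minP hLk (introT andP (conj k_gt0 (leqnn k))).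
have l_gt0 : 0 < lambda_k := rank_radii_gt0 k_gt0 Ek.
have [A [rkA LkE]] := hLk.
have [e [e1 eA]] : exists e : 'cV[R]_n, euclid_norm e = 1 /\ e^T *m A = 0.
  by apply: unit_normal_exists; rewrite rkA.
have orthL x : Lk x -> dotmx e x = 0.
  by rewrite LkE => -[z _ <-]; rewrite /dotmx mulmxA eA mul0mx mxE.
have [y [Ly h_ge y_le]] := high_point_exists e _ hLambda e1 (ltW l_gt0).
have ey : dotmx e y != 0 by rewrite gt_eqF // (lt_le_trans l_gt0).
exists (adjoin Lk y); split.
- exact: adjoin_lattice hLk orthL ey.
- exact: adjoin_sub hLambda hsub Ly.
- exact: adjoin_extension hLk orthL ey.
- by move=> j; exact: adjoin_succ_min hLk e1 orthL h_ge.
have [v01 _ _] := v_min.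
apply: le_trans (adjoin_succ_min_last k_gt0 hLk e1 orthL h_ge) _.
apply: le_trans y_le _; rewrite lerD2r -mulrA -[leLHS]mulr1.
by rewrite ler_pM2l // angle_factor_ge1.
Qed.
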